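(* Let $i,j\in I\setminus X$ be distinct with $\tau(i)=i$ and write $a=a_{ij}$. The structure constants $\rho_{m,m'}$ are symmetric in $m$ and $m'$ if $a$ is odd and antisymmetric if $a$ is even; that is, for all $m,m'\in\mathbb N$ with $m+m'\le-1-a$, $$\rho_{m,m'}=(-1)^{1-a}\rho_{m',m}.$$
   Context: General conventions: $\mathbb N=\{0,1,2,\dots\}$; empty sums are $0$, empty products are $1$, $0^0=1$. For $d\in\mathbb Z$: $d_e=\lfloor d/2\rfloor$, $d_p=d-2d_e\in\{0,1\}$. For a binary tuple $\boldsymbol\ell=(\ell_1,\dots,\ell_N)$: $|\boldsymbol\ell|=\ell_1+\dots+\ell_N$, and $|\boldsymbol\ell|_{r;s}=\ell_r+\dots+\ell_s$ if $r\le s$, $0$ otherwise. Expressions $(1-\ell_r)s_{r-|\boldsymbol\ell|_{1;r}}$ are read as $0$ when $\ell_r=1$. Setting: $\mathbb K$ is an algebraically closed field of characteristic $0$, $q$ an indeterminate, $A=(a_{ij})_{i,j\in I}$ an indecomposable symmetrizable generalized Cartan matrix with mutually coprime positive integers $\epsilon_i$ such that $(\epsilon_ia_{ij})$ is symmetric; $q_i=q^{\epsilon_i}$, $[m]_{q_i}=\frac{q_i^m-q_i^{-m}}{q_i-q_i^{-1}}$, with the corresponding $q_i$-binomial coefficients $\begin{bmatrix}N\\ m\end{bmatrix}_{q_i}=\frac{[N]_{q_i}!}{[m]_{q_i}![N-m]_{q_i}!}$, and $(N)_{q_i^2}=\frac{1-q_i^{2N}}{1-q_i^2}$. $(X,\tau)$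 is an admissible pair: $X\subseteq I$ is of finite type and $\tau$ is a permutation of $I$ with $\tau(X)=X$, $a_{\tau(i)\tau(j)}=a_{ij}$, $\tau^2=\mathrm{id}$, $h_{\tau(j)}=-w_X(h_j)$ and $\alpha_{\tau(j)}=-w_X(\alpha_j)$ for $j\in X$ ($w_X$ the longest element of the parabolic Weyl subgroup of $X$, $\alpha_i$ and $h_i$ the simple roots and coroots of the Kac–Moody algebra of $A$, $\alpha_j(h_i)=a_{ij}$), and $\alpha_i(\rho_X^\vee)\in\mathbb Z$ whenever $i\in I\setminus X$, $\tau(i)=i$ ($\rho_X^\vee$ half the sum of positive coroots of $X$). $c_i\in\mathbb K(q)^\times$ ($i\in I\setminus X$) are the parameters of the associated quantum symmetric pair coideal subalgebra. Structure constants: for $m,m'\in\mathbb N$ with $m+m'\le-1-a$, $\rho_{m,m'}=0$ if $a+m+m'$ is even, and otherwise $$\rho_{m,m'}=\left(\frac{c_iq_i^2}{q_i-q_i^{-1}}\right)^{\frac{1-a-m-m'}{2}}\sum_{k=m'}^{1-a-m}\ \sum_{\boldsymbol\ell\in\mathcal L_{m,m',k}}\ \sum_{\boldsymbol s\in\mathscr S_{m,m'}}(-1)^{k+1}\begin{bmatrix}1-a\\k\end{bmatrix}_{q_i}q_i^{\theta_{\boldsymbol\ell,\boldsymbol s,k}}\prod_{r=1}^{1-a}\left(\left(\zeta^{(r-1)}_{\boldsymbol\ell,\boldsymbol s}+1\right)_{q_i^2}\right)^{(1-\ell_r)s_{r-|\boldsymbol\ell|_{1;r}}},$$ with $\zeta^{(r)}_{\boldsymbol\ell,\boldsymbol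 s}=2|\boldsymbol s|_{1;r-|\boldsymbol\ell|_{1;r}}+|\boldsymbol\ell|_{1;r}-r$, $\theta_{\boldsymbol\ell,\boldsymbol s,k}=-a\,\zeta^{(1-a-k)}_{\boldsymbol\ell,\boldsymbol s}-2\sum_{r=1}^{1-a}\zeta^{(r-1)}_{\boldsymbol\ell,\boldsymbol s}$, $\mathcal L_{m,m',k}=\{\boldsymbol\ell\in\{0,1\}^{1-a}: |\boldsymbol\ell|_{1;1-a-k}=m,\ |\boldsymbol\ell|_{2-a-k;1-a}=m'\}$, and $\mathscr S_{m,m'}=\{\boldsymbol s\in\{0,1\}^{1-a-m-m'}:|\boldsymbol s|=\frac{1-a-m-m'}2,\ |\boldsymbol s|_{1;p}\ge\frac p2\ \forall p\in\{1,\dots,1-a-m-m'\}\}$. (These are the coefficients in $F_{ij}(B_i,B_j)=\sum_{m,m'}\rho_{m,m'}\mathcal Z_i^{(1-a-m-m')/2}B_i^mB_jB_i^{m'}$ for the coideal subalgebra generators $B_i$.) *)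

(* Defs.v *)
From HB Require Import structures.
From mathcomp Require Import all_boot all_order all_algebra all_fingroup.

Set Implicit Arguments.
Unset Strict Implicit.
Unset Printing Implicit Defensive.

Import Order.TTheory GRing.Theory Num.Theory.
Local Open Scope ring_scope.

(** ** Generalized Cartan matrices *)

Definition gcm (I : finType) (A : I -> I -> int) : Prop :=
  [/\ forall i, A i i = 2,
      forall i j, i != j -> A i j <= 0
    & forall i j, A i j = 0 <-> A j i = 0].

Definition indecomposable (I : finType) (A : I -> I -> int) : Prop :=
  forall J : {set I}, J != set0 -> J != setT ->
    exists i j, [/\ i \in J, j \notin J & A i j != 0].

(* "Mutually coprime" means that no integer greater than 1 divides all the
   entries; pairwise coprimality already fails in type B_3. *)
Definition symmetrizer (I : finType) (A : I -> I -> int) (eps : I -> nat) : Prop :=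
  [/\ forall i, (0 < eps i)%N,
      \big[gcdn/0%N]_(i : I) eps i = 1%N
    & forall i j, (eps i)%:Z * A i j = (eps j)%:Z * A j i].

(** ** Cartan subalgebra, Weyl group and admissible pairs *)

(* A realization of A in the sense of Kac: V is the Cartan subalgebra of the
   Kac-Moody algebra of A, h the simple coroots, alpha the simple roots. *)
Definition realization (K : fieldType) (I : finType) (A : I -> I -> int)
    (V : vectType K) (h : I -> V) (alpha : I -> 'Hom(V, K^o)) : Prop :=
  [/\ free (codom h),
      free (codom alpha),
      forall i j, alpha j (h i) = (A i j)%:~R
    & (\dim {:V} + \rank (\matrix_(r < #|I|, s < #|I|)
         ((A (enum_val r) (enum_val s))%:~R : K)) = 2 * #|I|)%N].

Section Weyl.

Variables (K : fieldType) (I : finType) (V : vectType K).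
Variables (h : I -> V) (alpha : I -> 'Hom(V, K^o)).

Definition simple_reflection (i : I) : 'End(V) :=
  linfun (fun v : V => v - (alpha i v : K) *: h i).

Definition weyl_word (w : seq I) : 'End(V) :=
  foldr (fun i g => (simple_reflection i \o g)%VF) \1%VF w.

(* The Weyl group acts on the dual of V contragrediently. *)
Definition weyl_dual (g : 'End(V)) (f : 'Hom(V, K^o)) : 'Hom(V, K^o) :=
  (f \o g^-1)%VF.

Definition parabolic (X : {set I}) (g : 'End(V)) : Prop :=
  exists2 w : seq I, all (mem X) w & g = weyl_word w.

Definition finite_type (X : {set I}) : Prop :=
  exists s : seq 'End(V), forall g, parabolic X g -> g \in s.

Definition reduced (w : seq I) : Prop :=
  forall w', weyl_word w' = weyl_word w -> (size w <= size w')%N.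

Definition longest_element (X : {set I}) (g : 'End(V)) : Prop :=
  exists w : seq I,
    [/\ all (mem X) w, reduced w, g = weyl_word w
      & forall w', all (mem X) w' -> reduced w' -> (size w' <= size w)%N].

(* For X of finite type every root is real, so the coroots of X are the
   W_X-conjugates of the simple coroots. *)
Definition positive_coroot (X : {set I}) (v : V) : Prop :=
  (exists g j, [/\ parabolic X g, j \in X & v = g (h j)]) /\
  (exists n : I -> nat, v = \sum_(j in X) h j *+ n j).

Definition half_sum_positive_coroots (X : {set I}) (rho : V) : Prop :=
  exists s : seq V,
    [/\ uniq s, forall v, v \in s <-> positive_coroot X v
      & rho = 2^-1 *: \sum_(v <- s) v].

Definition admissible_pair (A : I -> I -> int) (X : {set I}) (tau : {perm I}) :
    Prop :=
  finite_type X /\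
  exists (wX : 'End(V)) (rhoX : V),
    [/\ longest_element X wX & half_sum_positive_coroots X rhoX] /\
    [/\ tau @: X = X,
        forall i j, A (tau i) (tau j) = A i j,
        forall i, tau (tau i) = i,
        forall j, j \in X ->
          h (tau j) = - wX (h j) /\ alpha (tau j) = - weyl_dual wX (alpha j)
      & forall i, i \notin X -> tau i = i ->
          exists z : int, alpha i rhoX = z%:~R].

End Weyl.

(** ** Quantum numbers *)

Section QuantumNumbers.

Variables (F : fieldType) (x : F).

Definition qint (n : nat) : F := (x ^+ n - x ^- n) / (x - x^-1).

Definition qfact (n : nat) : F := \prod_(1 <= r < n.+1) qint r.

Definition qbinom (n m : nat) : F := qfact n / (qfact m * qfact (n - m)).

(* (n)_{x^2} *)
Definition qnum2 (n : int) : F := (1 - x ^ (2 * n)) / (1 - x ^+ 2).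

End QuantumNumbers.

(** ** Structure constants *)

(* Binary tuples are indexed from 1, as in l = (l_1, ..., l_N). *)
Definition entry (l : seq bool) (r : nat) : nat := nth false l r.-1.

(* |l|_{r;s} = l_r + ... + l_s, which is 0 when s < r *)
Definition psum (l : seq bool) (r s : nat) : nat :=
  (\sum_(r <= p < s.+1) entry l p)%N.

(* r - |l|_{1;r}, the number of indices p <= r with l_p = 0; the subtraction
   does not truncate. *)
Definition nzeros (l : seq bool) (r : nat) : nat := (r - psum l 1 r)%N.

Definition zeta (l s : seq bool) (r : nat) : int :=
  2 * (psum s 1 (nzeros l r))%:Z + (psum l 1 r)%:Z - r%:Z.

(* 1 - a as a natural number; only meaningful for a <= 1 *)
Definition Na (a : int) : nat := `|1 - a|%N.

Definition theta (a : int) (l s : seq bool) (k : nat) : int :=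
  - a * zeta l s (Na a - k) - 2 * \sum_(1 <= r < (Na a).+1) zeta l s r.-1.

Definition Lset (a : int) (m m' k : nat) : {set (Na a).-tuple bool} :=
  [set l : (Na a).-tuple bool |
     (psum l 1 (Na a - k) == m) && (psum l (Na a - k).+1 (Na a) == m')].

Definition Sset (a : int) (m m' : nat) : {set (Na a - m - m').-tuple bool} :=
  [set s : (Na a - m - m').-tuple bool |
     (2 * psum s 1 (Na a - m - m') == Na a - m - m')%N &&
     [forall p : 'I_(Na a - m - m').+1, (0 < p)%N ==> (p <= 2 * psum s 1 p)%N]].

(* x and c stand for q_i and c_i.  The exponent entry vanishes when l_r = 1,
   whatever the (possibly out of range) index of s is. *)
Definition rho (F : fieldType) (x c : F) (a : int) (m m' : nat) : F :=
  if (2 %| a + m%:Z + m'%:Z)%Z then 0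
  else (c * x ^+ 2 / (x - x^-1)) ^+ (Na a - m - m')./2 *
    \sum_(m' <= k < (Na a - m).+1)
      \sum_(l in Lset a m m' k)
        \sum_(s in Sset a m m')
          (-1) ^+ k.+1 * qbinom x (Na a) k * x ^ theta a l s k *
          \prod_(1 <= r < (Na a).+1)
            qnum2 x (zeta l s r.-1 + 1) ^+
              ((1 - entry l r) * entry s (nzeros l r)).

(** ** The field K(q) *)

Notation ratfun K := {fraction {poly K}}.

Definition qvar (K : fieldType) : ratfun K := tofrac 'X.

(* Main.v *)
(** Read a pair [(l, s)] as a lattice path with [N = 1 - a] steps: step [r] is
    flat if [l_r = 1], and otherwise goes up or down according to the next
    entry of [s]; then [zeta l s r] is the height after [r] steps, and the
    condition on [s] says that the path stays nonnegative and returns to [0].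
    Reversing the path exchanges [m] with [m'] and [k] with [N - k]; it
    preserves [theta] because the heights are merely permuted, and it preserves the
    product because such a path has as many steps from [h] to [h + 1] as from
    [h + 1] to [h].  So the triple sums agree term by term up to the sign
    [(-1) ^ N]. *)

Require Import Defs.
From mathcomp Require Import all_boot all_order all_algebra all_fingroup.
From mathcomp Require Import zify ring.

Set Implicit Arguments.
Unset Strict Implicit.
Unset Printing Implicit Defensive.

Import Order.TTheory GRing.Theory Num.Theory.
Local Open Scope ring_scope.

(** * Partial sums and zero counts under reversal *)

Lemma psum1S (l : seq bool) (r : nat) :
  psum l 1 r.+1 = (psum l 1 r + entry l r.+1)%N.
Proof. by rewrite /psum big_nat_recr. Qed.

Lemma psum1E (l : seq bool) (r : nat) : psum l 1 r = count id (take r l).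
Proof.
elim: r => [|r IHr]; first by rewrite take0 /psum big_geq.
rewrite psum1S IHr /entry /=.
have [lt_rl|le_lr] := ltnP r (size l).
  by rewrite (take_nth false) // -cats1 count_cat /= addn0.
by rewrite nth_default // !take_oversize ?addn0 // ltnW.
Qed.

Lemma psumD (l : seq bool) (r t : nat) :
  (r <= t)%N -> (psum l 1 r + psum l r.+1 t)%N = psum l 1 t.
Proof. by move=> le_rt; rewrite /psum -big_cat_nat. Qed.

Lemma psum1_le (l : seq bool) (r : nat) : (psum l 1 r <= r)%N.
Proof.
by elim: r => [|r IHr]; rewrite ?psum1S ?/entry; [rewrite /psum big_geq | lia].
Qed.

Lemma psum1_rev (l : seq bool) (r : nat) : (r <= size l)%N ->
  (psum (rev l) 1 r + psum l 1 (size l - r))%N = psum l 1 (size l).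
Proof.
move=> le_rl; rewrite !psum1E take_rev count_rev take_size addnC -count_cat.
by rewrite cat_take_drop.
Qed.

Lemma psum1_map_negb (s : seq bool) (p : nat) : (p <= size s)%N ->
  (psum [seq ~~ b | b <- s] 1 p + psum s 1 p)%N = p.
Proof.
move=> le_ps; rewrite !psum1E -map_take count_map addnC.
rewrite -[RHS](size_takel le_ps).
exact: count_predC.
Qed.

(** Walking a path backwards turns ups into downs, hence the negation. Flat steps are recorded in
    [l], which is only reversed. *)
Definition rev_steps (s : seq bool) : seq bool := [seq ~~ b | b <- rev s].

Lemma size_rev_steps (s : seq bool) : size (rev_steps s) = size s.
Proof. by rewrite size_map size_rev. Qed.

Lemma rev_stepsK : involutive rev_steps.
Proof.
by move=> s; rewrite /rev_steps -map_rev revK -map_comp map_id_in // => b _ /=;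
  rewrite negbK.
Qed.

Lemma psum1_rev_steps (s : seq bool) (p : nat) : (p <= size s)%N ->
  (psum (rev_steps s) 1 p + psum s 1 (size s))%N =
  (p + psum s 1 (size s - p))%N.
Proof.
move=> le_ps; have := @psum1_map_negb (rev s) p; rewrite size_rev => /(_ le_ps).
by have := psum1_rev le_ps; rewrite -/(rev_steps s); lia.
Qed.

Lemma nzeros_rev (l : seq bool) (r : nat) : (r <= size l)%N ->
  (nzeros (rev l) r + nzeros l (size l - r))%N = nzeros l (size l).
Proof.
move=> le_rl; rewrite /nzeros; have := psum1_rev le_rl.
have := psum1_le (rev l) r; have := psum1_le l (size l - r).
by have := psum1_le l (size l); lia.
Qed.

(** * Heights of a path and their steps *)

Lemma zetaE (l s : seq bool) (r : nat) :
  zeta l s r = 2 * (psum s 1 (nzeros l r))%:Z - (nzeros l r)%:Z.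
Proof. by rewrite /zeta /nzeros; have := psum1_le l r; lia. Qed.

Lemma zeta0 (l s : seq bool) : zeta l s 0 = 0.
Proof. by rewrite zetaE /nzeros /psum big_geq. Qed.

Lemma zetaS (l s : seq bool) (r : nat) : zeta l s r.+1 =
  zeta l s r + (1 - (entry l r.+1)%:Z) * (2 * (entry s (nzeros l r.+1))%:Z - 1).
Proof.
rewrite !zetaE /nzeros psum1S; have le_lr := psum1_le l r.
have : (entry l r.+1 <= 1)%N by rewrite /entry leq_b1.
case: (entry l r.+1) => [|[|//]] _; last by rewrite addn1 subSS; ring.
by rewrite addn0 subSn // psum1S; lia.
Qed.

(** This makes the product in [rho] a function of the heights alone. *)
Lemma up_step (l s : seq bool) (r : nat) :
  ((1 - entry l r.+1) * entry s (nzeros l r.+1))%N =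
  (zeta l s r.+1 == zeta l s r + 1).
Proof. by rewrite zetaS /entry; do 2!case: (nth _ _ _) => /=; lia. Qed.

Lemma zeta_step (l s : seq bool) (r : nat) :
  [\/ zeta l s r.+1 = zeta l s r, zeta l s r.+1 = zeta l s r + 1
    | zeta l s r.+1 = zeta l s r - 1].
Proof.
rewrite zetaS /entry; do 2!case: (nth _ _ _) => /=.
- by constructor 1; lia.
- by constructor 1; lia.
- by constructor 2; lia.
- by constructor 3; lia.
Qed.

(* Up to height [h], the up steps exceed the down steps by one at each of the
   levels [0, ..., h - 1]. *)
Lemma prod_up_steps (F : comNzRingType) (f : int -> F) (z : nat -> int)
    (N : nat) :
  z 0%N = 0 -> (forall r, (r <= N)%N -> 0 <= z r) ->
  (forall r, [\/ z r.+1 = z r, z r.+1 = z r + 1 | z r.+1 = z r - 1]) ->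
  \prod_(0 <= r < N) f (z r + 1) ^+ (z r.+1 == z r + 1) =
  \prod_(0 <= r < N) f (z r.+1 + 1) ^+ (z r == z r.+1 + 1) *
  \prod_(0 <= h < `|z N|%N) f (h%:Z + 1).
Proof.
move=> z0 z_ge0 z_step; elim: N z_ge0 => [|N IHN] z_ge0.
  by rewrite z0 !big_geq ?mulr1.
rewrite !big_nat_recr //= IHN; last by move=> r /leqW; apply: z_ge0.
have zN_ge0 := z_ge0 N (leqnSn N); have zSN_ge0 := z_ge0 N.+1 (leqnn _).
have [->|zE|zE] := z_step N.
- have -> : (z N == z N + 1) = false by lia.
  by rewrite !mulr1.
- have -> : (z N.+1 == z N + 1) by lia.
  have -> : (z N == z N.+1 + 1) = false by lia.
  have -> : `|z N.+1|%N = `|z N|.+1 by lia.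
  by rewrite big_nat_recr //= gez0_abs // !mulr1 expr1 mulrA.
(* On a down step the last factor of the level product becomes the factor of that step. *)
- have -> : (z N.+1 == z N + 1) = false by lia.
  have -> : (z N == z N.+1 + 1) by lia.
  have -> : `|z N|%N = `|z N.+1|.+1 by lia.
  by rewrite big_nat_recr //= gez0_abs // !mulr1 expr1; ring.
Qed.

(** * Ballot sequences *)

Definition ballot (s : seq bool) : Prop :=
  (2 * psum s 1 (size s) = size s)%N /\
  (forall p, (p <= size s)%N -> (p <= 2 * psum s 1 p)%N).

(** As the total height is 0, [psum1_rev_steps] says that the reversed sequence has at [p] the
    height of [s] at [size s - p]. *)
Lemma ballot_rev_steps (s : seq bool) : ballot s -> ballot (rev_steps s).
Proof.
move=> [s_bal s_ge]; rewrite /ballot size_rev_steps; split=> [|p le_ps].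
  have := @psum1_rev_steps s (size s) (leqnn _).
  by rewrite subnn [psum s 1 0]psum1E take0 /=; lia.
by have := psum1_rev_steps le_ps; have := s_ge _ (leq_subr p (size s)); lia.
Qed.

Lemma ballotP (a : int) (m m' : nat) (s : (Na a - m - m').-tuple bool) :
  reflect (ballot s) (s \in Sset a m m').
Proof.
rewrite inE /ballot size_tuple; apply: (iffP andP) => -[].
  move=> /eqP s_bal /forallP s_ge; split=> // -[//|p] le_p.
  by have := s_ge (Ordinal (le_p : (p.+1 < _.+1)%N)).
move=> /eqP-> s_ge; split=> //; apply/forallP=> p; apply/implyP=> _.
by apply: s_ge; rewrite -ltnS.
Qed.

(** * Heights, their sum and the product for a reversed path *)

Section PathReversal.

Variables l s : seq bool.
Hypotheses (size_s : size s = nzeros l (size l)) (s_ballot : ballot s).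

Lemma nzeros_le (r : nat) : (r <= size l)%N -> (nzeros l r <= size s)%N.
Proof.
move=> le_r; rewrite size_s -(nzeros_rev (leq_subr r (size l))) subKn //.
exact: leq_addl.
Qed.

Lemma zeta_ge0 (r : nat) : (r <= size l)%N -> 0 <= zeta l s r.
Proof.
by move=> /nzeros_le le_r; rewrite zetaE; have := s_ballot.2 _ le_r; lia.
Qed.

Lemma zeta_size : zeta l s (size l) = 0.
Proof. by rewrite zetaE -size_s; have := s_ballot.1; lia. Qed.

Lemma zeta_rev (r : nat) : (r <= size l)%N ->
  zeta (rev l) (rev_steps s) r = zeta l s (size l - r).
Proof.
move=> le_r; rewrite !zetaE; have := nzeros_rev le_r; rewrite -size_s.
have := nzeros_le (leq_subr r (size l)).
set n' := nzeros _ r; set n := nzeros _ _ => le_n defn.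
have le_n' : (n' <= size s)%N by lia.
have := psum1_rev_steps le_n'; have -> : (size s - n')%N = n by lia.
by have := s_ballot.1; lia.
Qed.

Lemma sum_zeta_rev :
  \sum_(1 <= r < (size l).+1) zeta (rev l) (rev_steps s) r.-1 =
  \sum_(1 <= r < (size l).+1) zeta l s r.-1.
Proof.
rewrite !big_add1 /= [LHS]big_nat_rev add0n.
transitivity (\sum_(0 <= r < size l) zeta l s r.+1).
  apply: eq_big_nat => r lt_r; rewrite zeta_rev; last lia.
  by congr (zeta _ _ _); lia.
(* Reversal has moved the range of positions from [0 .. N - 1] to [1 .. N]; this is harmless because
   both end heights are 0. *)
apply: (addrI (zeta l s 0)); rewrite -big_nat_recl // big_nat_recr //=.
by rewrite zeta0 zeta_size addrC.
Qed.

Lemma prod_qnum2_rev (F : fieldType) (x : F) :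
  \prod_(1 <= r < (size l).+1)
    qnum2 x (zeta (rev l) (rev_steps s) r.-1 + 1) ^+
      ((1 - entry (rev l) r) * entry (rev_steps s) (nzeros (rev l) r)) =
  \prod_(1 <= r < (size l).+1)
    qnum2 x (zeta l s r.-1 + 1) ^+ ((1 - entry l r) * entry s (nzeros l r)).
Proof.
rewrite !big_add1 /= [RHS](eq_bigr _ (fun r _ => congr1 _ (up_step l s r))).
rewrite (prod_up_steps _ (zeta0 l s) zeta_ge0 (zeta_step l s)).
(* The path ends at height 0, so the level product is empty. The right side now runs over down
   steps, which are the up steps of the reversed path. *)
rewrite zeta_size [in RHS](@big_geq _ _ _ 0 `|0|%N) // mulr1 big_nat_rev add0n.
apply: eq_big_nat => r lt_r; rewrite up_step !zeta_rev; try lia.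
have -> : (size l - (size l - r.+1))%N = r.+1 by lia.
by have -> : (size l - (size l - r.+1).+1)%N = r by lia.
Qed.

End PathReversal.

(** * Reindexing the triple sum *)

Section Rho.

Variables (F : fieldType) (x : F) (a : int).

Definition path_weight (l s : seq bool) (k : nat) : F :=
  x ^ theta a l s k *
  \prod_(1 <= r < (Na a).+1)
    qnum2 x (zeta l s r.-1 + 1) ^+ ((1 - entry l r) * entry s (nzeros l r)).

Lemma path_weight_rev (l s : seq bool) (k : nat) :
  size l = Na a -> size s = nzeros l (size l) -> ballot s -> (k <= Na a)%N ->
  path_weight (rev l) (rev_steps s) (Na a - k) = path_weight l s k.
Proof.
move=> size_l size_s s_ballot le_k; rewrite /path_weight /theta -size_l.
rewrite prod_qnum2_rev // sum_zeta_rev // zeta_rev //; last by lia.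
by congr (_ ^ (_ * zeta _ _ _ - _) * _); lia.
Qed.

Lemma qbinom_sym (n k : nat) : (k <= n)%N -> qbinom x n (n - k) = qbinom x n k.
Proof. by move=> le_kn; rewrite /qbinom subKn // [qfact x k * _]mulrC. Qed.

Lemma Lset_nzeros (m m' k : nat) (l : (Na a).-tuple bool) :
  l \in Lset a m m' k -> nzeros l (Na a) = (Na a - m - m')%N.
Proof.
rewrite inE => /andP[/eqP lm /eqP lm'].
by rewrite /nzeros -(psumD l (leq_subr k _)) lm lm' subnDA.
Qed.

Lemma Lset_rev (m m' k : nat) (l : (Na a).-tuple bool) : (k <= Na a)%N ->
  ([tuple of rev l] \in Lset a m m' k) = (l \in Lset a m' m (Na a - k)).
Proof.
move=> le_k; rewrite !inE /= subKn // andbC.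
have := @psum1_rev l (Na a - k); have := @psum1_rev l (Na a).
rewrite size_tuple subnn subKn // [psum l 1 0]psum1E take0 /= addn0.
move=> /(_ (leqnn _)) revN /(_ (leq_subr _ _)).
have := psumD l le_k; have := psumD (rev l) (leq_subr k (Na a)); rewrite revN.
by move=> ? ? ?; congr (_ && _); apply/eqP/eqP; lia.
Qed.

(** The lengths [Na a - m' - m] and [Na a - m - m'] are equal but not convertible, so the reversed
    tuple needs this cast. *)
Lemma rev_steps_tupleP (m m' : nat) (s : (Na a - m' - m).-tuple bool) :
  size (rev_steps s) == (Na a - m - m')%N.
Proof. by rewrite size_rev_steps size_tuple subnAC. Qed.

Lemma sum_path_weight_rev (m m' k : nat) : (k <= Na a)%N ->
  \sum_(l in Lset a m m' (Na a - k)) \sum_(s in Sset a m m')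
    path_weight l s (Na a - k) =
  \sum_(l in Lset a m' m k) \sum_(s in Sset a m' m) path_weight l s k.
Proof.
move=> le_k; rewrite (reindex (fun l : (Na a).-tuple bool => [tuple of rev l]));
  last by apply/onW_bij/inv_bij => l; apply: val_inj; rewrite /= revK.
apply: eq_big => [l|l l_in]; first by rewrite Lset_rev ?leq_subr // subKn.
rewrite Lset_rev ?leq_subr // subKn // in l_in.
(* The two tuple types differ, so the inverse is the same map with [m] and [m'] exchanged. *)
rewrite (reindex (fun s => Tuple (rev_steps_tupleP (m' := m') (m := m) s)));
  last by apply: onW_bij;
          exists (fun s => Tuple (rev_steps_tupleP (m' := m) (m := m') s)) => s;
          apply: val_inj; rewrite /= rev_stepsK.
apply: eq_big => [s|s /ballotP s_bal].
  apply/ballotP/ballotP => /=; last exact: ballot_rev_steps.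
  by move/ballot_rev_steps; rewrite rev_stepsK.
rewrite path_weight_rev ?size_tuple //; first by rewrite (Lset_nzeros l_in).
by move/ballot_rev_steps: s_bal; rewrite /= rev_stepsK.
Qed.

Lemma rho_path_weight (c : F) (m m' : nat) : rho x c a m m' =
  if (2 %| a + m%:Z + m'%:Z)%Z then 0
  else (c * x ^+ 2 / (x - x^-1)) ^+ (Na a - m - m')./2 *
    \sum_(m' <= k < (Na a - m).+1) (-1) ^+ k.+1 * qbinom x (Na a) k *
      \sum_(l in Lset a m m' k) \sum_(s in Sset a m m') path_weight l s k.
Proof.
rewrite /rho; case: ifP => // _; congr (_ * _); apply: eq_bigr => k _.
rewrite big_distrr; apply: eq_bigr => l _; rewrite big_distrr.
by apply: eq_bigr => s _; rewrite /path_weight /= !mulrA.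
Qed.

Lemma rho_swap (c : F) (m m' : nat) : (m + m' <= Na a)%N ->
  rho x c a m m' = (-1) ^+ Na a * rho x c a m' m.
Proof.
move=> le_mm'; rewrite !rho_path_weight [a + m'%:Z + _]addrAC.
case: ifP => _; first by rewrite mulr0.
rewrite [RHS]mulrCA; congr (_ ^+ _./2 * _); first exact: subnAC.
(* Both ranges of [k] are shifted to start at 0. Reversing the left one then pairs the index
   [Na a - (k + m)] with [k + m] on the right. *)
rewrite mulr_sumr -[X in \sum_(X <= _ < _ (Na a - m)%N) _]add0n.
rewrite -[X in _ = \sum_(X <= _ < _) _]add0n !big_addn.
have -> : ((Na a - m).+1 - m' = (Na a - m').+1 - m)%N by lia.
rewrite [LHS]big_nat_rev /=; apply: eq_big_nat => k lt_k.
have -> : (0 + ((Na a - m').+1 - m) - k.+1 + m' = Na a - (k + m))%N by lia.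
have le_k : (k + m <= Na a)%N by lia.
rewrite sum_path_weight_rev // qbinom_sym // [RHS]mulrA; congr (_ * _).
rewrite [RHS]mulrA -exprD; congr (_ * _).
(* The exponents [Na a - (k + m) + 1] and [Na a + (k + m) + 1] have the same parity. *)
by rewrite -[LHS]signr_odd -[RHS]signr_odd; congr (_ ^+ _); lia.
Qed.

End Rho.

Theorem proposition4p8
  (K : closedFieldType) (charK : [pchar K] =i pred0)
  (I : finType) (A : I -> I -> int) (eps : I -> nat)
  (A_gcm : gcm A) (A_indec : indecomposable A) (A_symm : symmetrizer A eps)
  (V : vectType K) (h : I -> V) (alpha : I -> 'Hom(V, K^o))
  (V_real : realization A h alpha)
  (X : {set I}) (tau : {perm I}) (X_adm : admissible_pair h alpha A X tau)
  (c : I -> ratfun K) (c_neq0 : forall i, i \notin X -> c i != 0)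
  (i j : I) (iX : i \notin X) (jX : j \notin X) (neq_ij : i != j)
  (tau_i : tau i = i) (m m' : nat) (le_mm' : m%:Z + m'%:Z <= - 1 - A i j) :
  rho (qvar K ^+ eps i) (c i) (A i j) m m' =
  (-1) ^ (1 - A i j) * rho (qvar K ^+ eps i) (c i) (A i j) m' m.
Proof.
(* [le_mm'] forces [A i j <= -1], so the absolute value in [Na] changes nothing. *)
have -> : 1 - A i j = (Na (A i j))%:Z by rewrite /Na; lia.
by apply: rho_swap; rewrite /Na; lia.
Qed.
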